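(* Let $F=\mathbb{Q}$ or $F=\mathbb{Q}(\sqrt5)$, let $K\supsetneq F$ be a totally real number field, and let $X\in\{\mathrm{nc},\mathrm{cl},\mathrm{diag}\}$. Then the set $\{\alpha\mathcal{U}_K^2:\alpha\in\mathcal{O}_F^+\}$ is not an $X$-criterion set for $K$; that is, there exists an $X$-lattice over $K$ which represents every element of $\mathcal{O}_F^+$ but is not universal.
   Context: For a totally real field $E$, $\mathcal{O}_E$ is its ring of integers, $\mathcal{U}_E$ its unit group, $\mathcal{O}_E^+$ its totally positive integers. A lattice over $K$ is a finitely generated torsion-free $\mathcal{O}_K$-module $L$ with a quadratic map $Q:L\to\mathcal{O}_K$ ($Q(av)=a^2Q(v)$, $B(v,w)=(Q(v+w)-Q(v)-Q(w))/2$ bilinear) with $Q(v)\in\mathcal{O}_K^+$ for $v\ne0$; classical if $B$ is $\mathcal{O}_K$-valued; the diagonal lattice $\langle a_1,\dots,a_n\rangle$ is $\mathcal{O}_K^n$ with $Q(x)=\sum a_ix_i^2$, $a_i\in\mathcal{O}_K^+$. An $X$-lattice is any lattice, a classical lattice, resp. a diagonal lattice for $X=\mathrm{nc},\mathrm{cl},\mathrm{diag}$. $L$ represents $\alpha$ if $Q(v)=\alpha$ for some $v$, and is universal if it represents all of $\mathcal{O}_K^+$. A set $\mathcal{C}\subset\mathcal{O}_K^+/\mathcal{U}_K^2$ is an $X$-criterion set for $K$ if every $X$-lattice over $K$ is universal if and only if it represents every element whose class lies in $\mathcal{C}$. *)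

(* Defs.v *)
From HB Require Import structures.
From mathcomp Require Import all_boot all_order all_algebra all_field.
From mathcomp Require Import boolp classical_sets.

Set Implicit Arguments.
Unset Strict Implicit.
Unset Printing Implicit Defensive.

Import Order.TTheory GRing.Theory Num.Theory.
Local Open Scope ring_scope.
Local Open Scope classical_set_scope.

(* A number field is a [fieldExtType rat].  Its complex embeddings are its ring
   morphisms to [algC], since the image of such an embedding is algebraic. *)

Definition totally_real (E : fieldExtType rat) : Prop :=
  forall (s : {rmorphism E -> algC}) (x : E), s x \is Num.real.

Definition totally_positive (E : fieldExtType rat) (x : E) : Prop :=
  forall s : {rmorphism E -> algC}, 0 < s x.

Definition is_alg_int (E : fieldExtType rat) (x : E) : bool :=
  `[< integralOver (intr : int -> E) x >].

Section RingOfIntegers.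
Variable E : fieldExtType rat.

Fact is_alg_int_subring : subring_closed (@is_alg_int E).
Proof.
split.
- by apply/asboolP; apply: integral1.
- by move=> x y /asboolP ix /asboolP iy; apply/asboolP; apply: integral_sub.
- by move=> x y /asboolP ix /asboolP iy; apply/asboolP; apply: integral_mul.
Qed.

HB.instance Definition _ :=
  GRing.isSubringClosed.Build E (@is_alg_int E) is_alg_int_subring.

Record ringInt := RingInt { int_val : E; _ : is_alg_int int_val }.

HB.instance Definition _ := [isSub for int_val].
HB.instance Definition _ := [Choice of ringInt by <:].
HB.instance Definition _ := [SubChoice_isSubComNzRing of ringInt by <:].

Definition ringInt_unit : {pred ringInt} :=
  fun x => `[< exists y, y * x = 1 >].

Definition ringInt_inv (x : ringInt) : ringInt :=
  if pselect (exists y, y * x = 1) is left h then sval (cid h) else x.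

Fact ringInt_mulVx : {in ringInt_unit, left_inverse 1 ringInt_inv *%R}.
Proof.
move=> x /asboolP ux; rewrite /ringInt_inv.
by case: pselect => // h; case: cid.
Qed.

Fact ringInt_unitPl (x y : ringInt) : y * x = 1 -> ringInt_unit x.
Proof. by move=> yx1; apply/asboolP; exists y. Qed.

Fact ringInt_invr_out : {in [predC ringInt_unit], ringInt_inv =1 id}.
Proof.
move=> x /asboolPn nux; rewrite /ringInt_inv.
by case: pselect.
Qed.

HB.instance Definition _ := GRing.ComNzRing_hasMulInverse.Build ringInt
  ringInt_mulVx ringInt_unitPl ringInt_invr_out.

Fact ringInt_idomain : GRing.integral_domain_axiom ringInt.
Proof.
move=> x y /(congr1 (val : ringInt -> E)); rewrite rmorphM rmorph0 => /eqP.
by rewrite mulf_eq0 -!(rmorph0 (val : ringInt -> E)) !(inj_eq val_inj).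
Qed.

HB.instance Definition _ :=
  GRing.ComUnitRing_isIntegral.Build ringInt ringInt_idomain.

Definition posInt : set ringInt := [set a | totally_positive (val a)].

Definition sq_class (a : ringInt) : set ringInt :=
  [set a * u ^+ 2 | u in [set u : ringInt | u \is a GRing.unit]].

(* The quotient of the totally positive integers by the squares of units, its
   elements being the cosets seen as sets of integers. *)
Definition pos_sq_classes : set (set ringInt) := sq_class @` posInt.

End RingOfIntegers.

Arguments posInt E : clear implicits.
Arguments pos_sq_classes E : clear implicits.

Section Lattices.
Variable K : fieldExtType rat.
Local Notation OK := (ringInt K).

Definition polar (L : lmodType OK) (Q : L -> OK) (v w : L) : K :=
  val (Q (v + w) - Q v - Q w) / 2%:R.

Record lattice := Lattice {
  lat_mod :> lmodType OK;
  lat_fg : exists s : seq lat_mod, forall v : lat_mod,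
    exists c : 'I_(size s) -> OK, v = \sum_(i < size s) c i *: s`_i;
  lat_torsion_free : forall (a : OK) (v : lat_mod),
    a *: v = 0 -> a = 0 \/ v = 0;
  qform : lat_mod -> OK;
  qformZ : forall (a : OK) (v : lat_mod), qform (a *: v) = a ^+ 2 * qform v;
  polarPl : forall (a : OK) (u v w : lat_mod),
    polar qform (a *: u + v) w = val a * polar qform u w + polar qform v w;
  polarPr : forall (a : OK) (u v w : lat_mod),
    polar qform w (a *: u + v) = val a * polar qform w u + polar qform w v;
  qform_pos : forall v : lat_mod, v != 0 -> qform v \in posInt K
}.

Definition classical_lattice (L : lattice) : Prop :=
  forall v w : L, is_alg_int (polar (@qform L) v w).

Definition diag_form (n : nat) (a x : 'rV[OK]_n) : OK :=
  \sum_(i < n) a 0 i * x 0 i ^+ 2.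

Definition diagonal_lattice (L : lattice) : Prop :=
  exists (n : nat) (a : 'rV[OK]_n) (f : {linear 'rV[OK]_n -> L}),
    [/\ forall i, a 0 i \in posInt K,
        bijective f &
        forall x, qform (f x) = diag_form a x].

Inductive lattice_kind := nc | cl | diag.

Definition X_lattice (X : lattice_kind) (L : lattice) : Prop :=
  match X with
  | nc => True
  | cl => classical_lattice L
  | diag => diagonal_lattice L
  end.

Definition represents (L : lattice) (a : OK) : Prop :=
  exists v : L, qform v = a.

Definition universal (L : lattice) : Prop :=
  forall a, a \in posInt K -> represents L a.

Definition criterion_set (X : lattice_kind) (C : set (set OK)) : Prop :=
  C `<=` pos_sq_classes K /\
  forall L : lattice, X_lattice X L ->
    (universal L <->
     forall a, a \in posInt K -> C (sq_class a) -> represents L a).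

End Lattices.

Section Subfield.
Variables (K : fieldExtType rat) (F : {subfield K}).

Fact vsval_alg_int (b : ringInt (subvs_of F)) : is_alg_int (vsval (val b)).
Proof.
have /asboolP [p mp pb] := valP b; apply/asboolP; exists p => //=.
have -> : map_poly (intr : int -> K) p =
          map_poly (vsval : subvs_of F -> K) (map_poly intr p).
  by rewrite -map_poly_comp; apply: eq_map_poly => z /=; rewrite rmorph_int.
by rewrite fmorph_root.
Qed.

Definition ringInt_incl (b : ringInt (subvs_of F)) : ringInt K :=
  RingInt (vsval_alg_int b).

Lemma ringInt_incl_posInt (b : ringInt (subvs_of F)) :
  b \in posInt (subvs_of F) -> ringInt_incl b \in posInt K.
Proof.
rewrite !inE => pb s; exact: (pb (s \o (vsval : subvs_of F -> K))).
Qed.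

(* The classes in K of the totally positive integers of F, total positivity
   being taken with respect to the embeddings of F. *)
Definition subfield_classes : set (set (ringInt K)) :=
  [set sq_class (ringInt_incl b) | b in posInt (subvs_of F)].

Lemma subfield_classes_pos : subfield_classes `<=` pos_sq_classes K.
Proof.
move=> _ [b pb <-]; exists (ringInt_incl b) => //.
by apply/set_mem/ringInt_incl_posInt/mem_set.
Qed.

End Subfield.

(* Main.v *)
(* The lattice is L = <1, rho, 2, ..., 2> with eight 2's, where rho = 2 if F = Q
   and rho = phi + 2 = 1 + phi^2, phi the golden ratio, if F = Q(sqrt 5).

   L represents the totally positive integers of F.  Over Z this is Lagrange's
   theorem, since n = (n mod 2) + 2 (n div 2).  In Z[phi] a totally positive
   integer is, up to the square of a unit, a + b phi^2 with a, b natural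
   numbers; reducing a and b modulo 2 leaves one of 0, 1, phi^2, 1 + phi^2.

   L is not universal over K.  Suppose it is, and let x be of least trace m
   among the totally positive integers of K outside F; by AM-GM m > d, the
   degree of K.  All coefficients of L except the first are sums of two totally
   positive integers of F, so a representation of x, or of x + 1, involves
   nothing but the first coordinate: x = r^2 and x + 1 = z^2.  All coefficients
   are squares modulo 2, so every integer of K is a square modulo 2 (add an even
   integer to make it totally positive), which forces O_K / 2 to be reduced.  As
   (z - r - 1)^2 is even, z = r + 1 + 2 e, and r^2 + 1 = z^2 then shows that r
   is even.  But then (r / 2)^2 has trace m / 4. *)
From HB Require Import structures.
Require Import Defs.
From mathcomp Require Import all_boot all_order all_algebra all_field.
From mathcomp Require Import boolp classical_sets zify ring.

Set Implicit Arguments.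
Unset Strict Implicit.
Unset Printing Implicit Defensive.

Import Order.TTheory GRing.Theory Num.Theory.
Local Open Scope ring_scope.

(** * Complex embeddings, trace and norm *)
Section Embeddings.
Variable K : fieldExtType rat.

Lemma number_field_separable (x : K) : separable_element 1 x.
Proof. by apply: pcharf0_separable => p; rewrite pchar_lalg pchar_num. Qed.

Lemma number_field_generator : exists t : K, <<1; t>>%VS = fullv.
Proof.
exists (separable_generator 1 {:K}).
have sep: separable 1 {:K} by apply/separableP => y _; apply: number_field_separable.
by rewrite -(eq_adjoin_separable_generator sep (sub1v _)).
Qed.

Definition ratr_horner (r : algC) : {rmorphism {poly rat} -> algC} :=
  horner_morph (fun a : rat => mulrC r (ratr a)).

Section Generator.
Variable t : K.
Hypothesis genK : <<1; t>>%VS = fullv.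

(** The degree bound makes the coefficients of [q] the coordinates of [v] in the power basis of
    [t]. *)
Lemma gen_polyP (v : K) :
  exists q : {poly rat}, (size q <= adjoin_degree 1 t)%N /\ horner_alg t q = v.
Proof.
have /polyOver1P [q Dq] := Fadjoin_polyOver 1 t v; exists q.
rewrite /horner_alg /horner_morph -Dq Fadjoin_poly_eq ?genK ?memvf //; split => //.
by rewrite -(size_map_poly (in_alg K)) -Dq size_Fadjoin_poly.
Qed.

Definition gen_poly v := sval (cid (gen_polyP v)).

Lemma size_gen_poly v : (size (gen_poly v) <= adjoin_degree 1 t)%N.
Proof. by rewrite /gen_poly; case: cid => q []. Qed.

Lemma gen_polyE v : horner_alg t (gen_poly v) = v.
Proof. by rewrite /gen_poly; case: cid => q []. Qed.

Variable r : algC.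
Hypothesis root_r : forall q : {poly rat}, horner_alg t q = 0 -> ratr_horner r q = 0.

(** The embedding sending [t] to [r]. By [root_r] its value does not depend on the polynomial chosen
    for [v], whence additivity and multiplicativity. *)
Definition gen_embed (v : K) : algC := ratr_horner r (gen_poly v).

Lemma gen_embed_horner (q : {poly rat}) : gen_embed (horner_alg t q) = ratr_horner r q.
Proof.
apply/eqP; rewrite -subr_eq0 -rmorphB; apply/eqP/root_r.
by rewrite rmorphB /= gen_polyE subrr.
Qed.

Fact gen_embed_additive : zmod_morphism gen_embed.
Proof.
move=> x y; rewrite -{1}[x]gen_polyE -{1}[y]gen_polyE -rmorphB.
by rewrite gen_embed_horner rmorphB.
Qed.

Fact gen_embed_multiplicative : monoid_morphism gen_embed.
Proof.
split=> [|x y]; first by rewrite -(rmorph1 (horner_alg t)) gen_embed_horner rmorph1.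
rewrite -{1}[x]gen_polyE -{1}[y]gen_polyE -rmorphM.
by rewrite gen_embed_horner rmorphM.
Qed.

HB.instance Definition _ :=
  GRing.isZmodMorphism.Build K algC gen_embed gen_embed_additive.
HB.instance Definition _ :=
  GRing.isMonoidMorphism.Build K algC gen_embed gen_embed_multiplicative.

Definition gen_morph : {rmorphism K -> algC} := gen_embed.

Lemma gen_morph_gen : gen_morph t = r.
Proof.
by rewrite -[X in gen_morph X](horner_algX t) /gen_morph /= gen_embed_horner /ratr_horner /= horner_morphX.
Qed.

End Generator.

(* Vandermonde conjugates the matrix of multiplication by [x] in the basis of
   powers of a generator to the diagonal matrix of the conjugates of [x]. *)
Lemma embeddings_exist : exists n (s : 'I_n.+1 -> {rmorphism K -> algC}),
  forall x, \sum_i s i x \in Crat /\ \prod_i s i x \in Crat.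
Proof.
have [t genK] := number_field_generator.
have /polyOver1P [mu Dmu] := minPolyOver 1 t.
have [rs Drs] := closed_field_poly_normal (map_poly (ratr : rat -> algC) mu).
have mu_monic: mu \is monic.
  by rewrite -(map_monic (in_alg K)) -Dmu monic_minPoly.
rewrite lead_coef_map (monicP mu_monic) rmorph1 scale1r in Drs.
(* Separability makes the roots distinct, and so the Vandermonde matrix invertible. *)
have Urs: uniq rs.
  rewrite -separable_prod_XsubC -Drs separable_map -(separable_map (in_alg K)).
  by rewrite -Dmu; apply: number_field_separable.
have Srs: size rs = adjoin_degree 1 t.
  apply: succn_inj; rewrite -size_minPoly Dmu size_map_poly.
  by rewrite -(size_map_poly (ratr : {rmorphism rat -> algC})) Drs size_prod_XsubC.
have root_rs r (q : {poly rat}): r \in rs -> horner_alg t q = 0 -> ratr_horner r q = 0.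
  move=> rs_r qt0; have: mu %| q.
    rewrite -(dvdp_map (in_alg K)) -Dmu minPoly_dvdp ?alg_polyOver //.
    exact/eqP.
  case/dvdpP => p ->; rewrite rmorphM; apply/eqP; rewrite mulf_eq0 orbC.
  by rewrite /ratr_horner /= /horner_morph Drs -rootE root_prod_XsubC rs_r.
have := Srs; have: (0 < adjoin_degree 1 t)%N by [].
case Dn: (adjoin_degree 1 t) => [//|n] _ Srn.
have rsP (i : 'I_n.+1) : rs`_i \in rs by rewrite mem_nth // Srn.
pose s (i : 'I_n.+1) := gen_morph genK (fun q => @root_rs _ q (rsP i)).
have sgen i : s i t = rs`_i by apply: gen_morph_gen.
exists n, s => x.
pose A : 'M[rat]_n.+1 := \matrix_(j, i) (gen_poly genK (x * t ^+ j))`_i.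
pose V : 'M[algC]_n.+1 := Vandermonde n.+1 (\row_i rs`_i).
pose D : 'M[algC]_n.+1 := diag_mx (\row_i s i x).
(* Entry [(j, k)] of either side is [s k (x * t ^+ j)]. *)
have AV : map_mx ratr A *m V = V *m D.
  apply/matrixP => j k; rewrite mul_mx_diag !mxE.
  have -> : rs`_k ^+ j * s k x = s k (x * t ^+ j) by rewrite rmorphM rmorphXn sgen mulrC.
  rewrite /s /gen_morph /= /gen_embed /ratr_horner /= /horner_morph horner_coef.
  rewrite size_map_poly; have := size_gen_poly genK (x * t ^+ j); rewrite Dn => sz.
  rewrite (big_ord_widen n.+1 (fun i => (map_poly ratr (gen_poly genK (x * t ^+ j)))`_i * rs`_k ^+ i)) //.
  rewrite [RHS]big_mkcond /=; apply: eq_bigr => i _; rewrite !mxE coef_map.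
  by case: ltnP => // le; rewrite nth_default // rmorph0 mul0r.
have Vunit : V \in unitmx.
  rewrite unitmxE unitfE det_Vandermonde; apply/prodf_neq0 => i _.
  apply/prodf_neq0 => j ij; rewrite !mxE subr_eq0 nth_uniq ?Srn //.
  by rewrite neq_ltn ij orbT.
have DE : D = invmx V *m (map_mx ratr A *m V) by rewrite AV mulKmx.
split.
  have -> : \sum_i s i x = \tr D by rewrite mxtrace_diag; apply: eq_bigr => i _;
    rewrite mxE.
  by rewrite DE mxtrace_mulC mulmxK // trace_map_mx; apply: Crat_rat.
have -> : \prod_i s i x = \det D by rewrite det_diag; apply: eq_bigr => i _; rewrite mxE.
rewrite DE !det_mulmx mulrCA -det_mulmx mulVmx // det1 mulr1 det_map_mx.
exact: Crat_rat.
Qed.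

End Embeddings.

(** * Lagrange's four-square theorem *)
Section FourSquares.

Definition four_squares (n : int) : Prop :=
  exists a b c d : int, n = a ^+ 2 + b ^+ 2 + c ^+ 2 + d ^+ 2.

(** Euler's identity: the norm of quaternions is multiplicative. *)
Lemma four_squaresM (m n : int) :
  four_squares m -> four_squares n -> four_squares (m * n).
Proof.
move=> [a [b [c [d ->]]]] [x [y [z [w ->]]]].
exists (a * x + b * y + c * z + d * w), (a * y - b * x + c * w - d * z),
  (a * z - c * x + d * y - b * w), (a * w - d * x + b * z - c * y).
ring.
Qed.

Lemma centered_mod (m a : int) : 0 < m ->
  exists r k : int, [/\ a = r + m * k, - m <= 2 * r & 2 * r <= m].
Proof.
move=> m0; have [k [r [Da [r0 rm]]]] : exists k r : int, a = k * m + r /\ 0 <= r /\ r < m.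
  exists (a %/ m)%Z, (a %% m)%Z; rewrite -divz_eq; split=> //; split.
    by rewrite modz_ge0 // gt_eqF.
  by rewrite ltz_pmod.
have [h|h] := leP (2 * r) m.
  by exists r, k; split; lia.
by exists (r - m), (k + 1); split; lia.
Qed.

(** Pigeonhole: for odd [p], the [(p + 1) / 2] residues [i ^ 2] and the [(p + 1) / 2] residues
    [- 1 - j ^ 2] are too many to be disjoint modulo [p]. *)
Lemma four_squares_multiple (p : nat) : prime p ->
  exists x y : nat, [/\ (2 * x <= p)%N, (2 * y <= p)%N & (p %| (x ^ 2 + y ^ 2).+1)%N].
Proof.
move=> pp; have [p2|p2] := leqP p 2.
  have -> : p = 2 by have := prime_gt1 pp; lia.
  by exists 1%N, 0%N.
have pd : odd p by case: (even_prime pp) => // ?; lia.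
pose h := (p./2).+1; have Dh : p = (2 * h - 1)%N by rewrite /h; lia.
have p0 := prime_gt0 pp.
pose f (i : 'I_h) : 'I_p := Ordinal (ltn_pmod (i ^ 2) p0).
(* The summand [p * p] keeps the truncated subtraction exact. *)
pose g (i : 'I_h) : 'I_p := Ordinal (ltn_pmod (p * p - (i ^ 2).+1) p0).
have sqinj (i j : 'I_h) : (i <= j)%N -> (i ^ 2 = j ^ 2 %[mod p])%N -> i = j.
  move=> ij /eqP; rewrite eq_sym eqn_mod_dvd ?leq_exp2r // subn_sqr Euclid_dvdM //.
  have := ltn_ord i; have := ltn_ord j => jh ih.
  case/orP => [/dvdnP [[|k] Dk]|/dvdnP [[|k] Dk]]; apply: val_inj => /=; nia.
have sqinj2 (i j : 'I_h) : (i ^ 2 = j ^ 2 %[mod p])%N -> i = j.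
  move=> E; case: (leqP i j) => ij; first exact: sqinj.
  by apply/esym/sqinj; rewrite ?(ltnW ij).
have finj : injective f by move=> i j /(congr1 val) /= /sqinj2.
have lt_sq (i : 'I_h) : (i ^ 2 < p * p)%N by have := ltn_ord i; nia.
have ginj : injective g.
  move=> i j /(congr1 val) /= /esym/eqP E; apply: sqinj2; apply/eqP.
  have := lt_sq i; have := lt_sq j; move: E.
  set a := (i ^ 2)%N; set b := (j ^ 2)%N; move=> E hb ha.
  rewrite -(eqn_modDr (p * p - a.+1).+1).
  have -> : (a + (p * p - a.+1).+1 = b + (p * p - b.+1).+1)%N by lia.
  by rewrite eqn_modDl -addn1 -[(p * p - a.+1).+1]addn1 eqn_modDr.
have : (0 < #|f @: 'I_h :&: g @: 'I_h|)%N.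
  have := cardsUI (f @: 'I_h) (g @: 'I_h); rewrite !card_imset // card_ord.
  have : (#|f @: 'I_h :|: g @: 'I_h| <= p)%N by rewrite -[p in leqRHS]card_ord max_card.
  by lia.
case/card_gt0P => u; rewrite inE => /andP [/imsetP [i _ Du] /imsetP [j _]].
rewrite {u}Du => /(congr1 val) /= E; exists i, j.
have := ltn_ord i; have := ltn_ord j => jh ih; split; try lia.
rewrite -addnS /dvdn -modnDml E modnDml subnK ?lt_sq //.
by rewrite modnMl.
Qed.

Lemma centered_sqr (m u : int) : - m <= 2 * u -> 2 * u <= m -> 4 * u ^+ 2 <= m * m.
Proof.
move=> h1 h2; rewrite -subr_ge0.
have -> : m * m - 4 * u ^+ 2 = (m - 2 * u) * (m + 2 * u) by ring.
by rewrite mulr_ge0; lia.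
Qed.

Lemma sum4_sqr_eq0 (x y z w : int) : x ^+ 2 + y ^+ 2 + z ^+ 2 + w ^+ 2 = 0 ->
  [/\ x = 0, y = 0, z = 0 & w = 0].
Proof.
move=> E; have := (sqr_ge0 x, sqr_ge0 y, sqr_ge0 z, sqr_ge0 w).
move=> [[[hx hy] hz] hw].
by split; apply/eqP; rewrite -sqrf_eq0; apply/eqP; move: E hx hy hz hw;
   move: (x ^+ 2) (y ^+ 2) (z ^+ 2) (w ^+ 2); lia.
Qed.

Lemma half_mod (m u : int) : 4 * u ^+ 2 = m * m ->
  exists e : int, 2 * u = m + 2 * m * e.
Proof.
move=> H; have : (2 * u - m) * (2 * u + m) = 0.
  by rewrite mulrDr !mulrBl -H; ring.
by move/eqP; rewrite mulf_eq0 => /orP [] /eqP h; [exists 0 | exists (-1)]; lia.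
Qed.

(** An integer congruent to [m / 2] modulo [m] has square [m ^ 2 / 4] modulo [m ^ 2], so that four
    such squares add up to a multiple of [m ^ 2]. *)
Lemma half_mod_sqr (m u e v : int) : 2 * u = m + 2 * m * e ->
  4 * (u + m * v) ^+ 2 = m * m + 4 * (m * m) * ((e + v) + (e + v) ^+ 2).
Proof.
move=> Hu; have -> : 4 * (u + m * v) ^+ 2 = (2 * u + 2 * m * v) ^+ 2 by ring.
by rewrite Hu; ring.
Qed.

Lemma prime_no_proper_factor (p : nat) (m k : int) :
  prime p -> 1 < m -> m < p%:Z -> p%:Z = m * k -> False.
Proof.
move=> /primeP [_ H] m1 mp pk.
have : (`|m| %| p)%N.
  by apply/dvdnP; exists `|k|%N; rewrite -abszM mulrC -pk absz_nat.
by move/H => /orP [] /eqP; lia.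
Qed.

(** The centered residues modulo [m] of the four roots have squares adding up to [m * q] with
    [q <= m]. Euler's identity writes [m p * m q] as the sum of four squares of multiples of [m];
    dividing by [m ^ 2] leaves [q p]. *)
Lemma four_squares_descent (p : nat) (m : int) : prime p -> 1 < m -> m < p%:Z ->
  four_squares (m * p%:Z) -> exists2 r : int, 0 < r < m & four_squares (r * p%:Z).
Proof.
move=> pp m1 mp [a [b [c [d E]]]]; have m0 : 0 < m by lia.
have [x [x' [Da x1 x2]]] := centered_mod a m0.
have [y [y' [Db y1 y2]]] := centered_mod b m0.
have [z [z' [Dc z1 z2]]] := centered_mod c m0.
have [w [w' [Dd w1 w2]]] := centered_mod d m0.
have nodiv := prime_no_proper_factor pp m1 mp.
have X := centered_sqr x1 x2; have Y := centered_sqr y1 y2.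
have Z := centered_sqr z1 z2; have W := centered_sqr w1 w2.
clear x1 x2 y1 y2 z1 z2 w1 w2.
pose q := p%:Z - 2 * (x * x' + y * y' + z * z' + w * w')
          - m * (x' ^+ 2 + y' ^+ 2 + z' ^+ 2 + w' ^+ 2).
have Eq : x ^+ 2 + y ^+ 2 + z ^+ 2 + w ^+ 2 = m * q.
  by rewrite /q !mulrBr E Da Db Dc Dd; ring.
(* [q = 0] would make [a], [b], [c], [d] multiples of [m], and [m] a divisor of [p]. *)
clearbody q; have q0 : 0 < q.
  have : 0 <= m * q by rewrite -Eq !addr_ge0 ?sqr_ge0.
  rewrite pmulr_rge0 // le_eqVlt => /orP [/eqP q0|//].
  have [x0 y0 z0 w0] : [/\ x = 0, y = 0, z = 0 & w = 0].
    by apply: sum4_sqr_eq0; rewrite Eq -q0 mulr0.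
  case: (nodiv (x' ^+ 2 + y' ^+ 2 + z' ^+ 2 + w' ^+ 2)).
  by apply: (mulfI (lt0r_neq0 m0)); rewrite E Da Db Dc Dd x0 y0 z0 w0; ring.
have qm : q < m.
  have : m * q <= m * m.
    rewrite -Eq; clear - X Y Z W; move: X Y Z W.
    by move: (x ^+ 2) (y ^+ 2) (z ^+ 2) (w ^+ 2) (m * m); lia.
  rewrite ler_pM2l // le_eqVlt => /orP [/eqP qm|//].
  (* [q = m] makes every residue plus or minus [m / 2], and again [m] divides [p]. *)
  have [Ex Ey Ez Ew] : [/\ 4 * x ^+ 2 = m * m, 4 * y ^+ 2 = m * m,
     4 * z ^+ 2 = m * m & 4 * w ^+ 2 = m * m].
    rewrite qm in Eq; clear - X Y Z W Eq; move: X Y Z W Eq.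
    by move: (x ^+ 2) (y ^+ 2) (z ^+ 2) (w ^+ 2) (m * m) => *; split; lia.
  have [ex Hx] := half_mod Ex; have [ey Hy] := half_mod Ey.
  have [ez Hz] := half_mod Ez; have [ew Hw] := half_mod Ew.
  case: (nodiv (1 + ((ex + x') + (ex + x') ^+ 2) + ((ey + y') + (ey + y') ^+ 2)
            + ((ez + z') + (ez + z') ^+ 2) + ((ew + w') + (ew + w') ^+ 2))).
  apply: (mulfI (lt0r_neq0 m0)); apply: (@mulfI _ 4) => //.
  rewrite E Da Db Dc Dd !(mulrDr 4) (half_mod_sqr _ Hx) (half_mod_sqr _ Hy).
  by rewrite (half_mod_sqr _ Hz) (half_mod_sqr _ Hw); ring.
exists q; first by rewrite q0.
(* Euler's four bilinear forms divided by [m], after substituting [a = x + m * x'] and so on. *)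
exists (q + x * x' + y * y' + z * z' + w * w'),
  (x' * y - y' * x + z' * w - w' * z), (x' * z - z' * x + w' * y - y' * w),
  (x' * w - w' * x + y' * z - z' * y).
apply: (mulfI (lt0r_neq0 m0)); apply: (mulfI (lt0r_neq0 m0)).
have -> : m * (m * (q * p%:Z)) = (m * p%:Z) * (m * q) by ring.
have -> : forall e f g h : int, m * (m * (e ^+ 2 + f ^+ 2 + g ^+ 2 + h ^+ 2)) =
   (m * e) ^+ 2 + (m * f) ^+ 2 + (m * g) ^+ 2 + (m * h) ^+ 2 by move=> *; ring.
by rewrite E !mulrDr -Eq Da Db Dc Dd; ring.
Qed.

Lemma four_squares_prime (p : nat) : prime p -> four_squares p%:Z.
Proof.
move=> pp; have p1 := prime_gt1 pp.
suff H : forall n (m : int), `|m|%N = n -> 0 < m -> m < p%:Z ->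
    four_squares (m * p%:Z) -> four_squares p%:Z.
  have [x [y [hx hy /dvdnP [k Dk]]]] := four_squares_multiple pp.
  have kp : (k < p)%N by nia.
  apply: (H k k%:Z) => //; [lia|exists 1, x%:Z, y%:Z, 0].
  by rewrite -PoszM -Dk; lia.
elim/ltn_ind => n IH m Dn m0 mp fs.
have [m1|m1] := leP m 1; first by have m1' : m = 1 by [lia]; rewrite m1' mul1r in fs.
have [r /andP [r0 rm] fr] := four_squares_descent pp m1 mp fs.
by apply: (IH `|r|%N _ r) => //; lia.
Qed.

Lemma four_squares_nat (n : nat) : four_squares n%:Z.
Proof.
elim/ltn_ind: n => n IH; have [n1|n1] := leqP n 1.
  by exists n%:Z, 0, 0, 0; case: n n1 {IH} => [|[|]].
have pp := pdiv_prime n1; have /dvdnP [k Dk] := pdiv_dvd n.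
rewrite Dk PoszM; apply: four_squaresM; last exact: four_squares_prime.
by apply: IH; have := prime_gt1 pp; nia.
Qed.

End FourSquares.

(** * Total positivity and the trace *)
Section Positivity.
Variable K : fieldExtType rat.
Hypothesis K_real : totally_real K.
Local Notation OK := (ringInt K).

Lemma alg_int_Aint (s : {rmorphism K -> algC}) (x : OK) : s (val x) \in Aint.
Proof.
have /asboolP [p p_monic px] := valP x.
have rp : root (map_poly intr p) (s (val x)).
  have -> : map_poly intr p = map_poly s (map_poly intr p).
    by rewrite -map_poly_comp; apply: eq_map_poly => z /=; rewrite rmorph_int.
  by rewrite fmorph_root.
apply: (root_monic_Aint rp); first by rewrite monic_map.
by apply/polyOverP => i; rewrite coef_map /= rpred_int_num.
Qed.

Definition totally_nonneg (x : K) := forall s : {rmorphism K -> algC}, 0 <= s x.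

Lemma posIntP (a : OK) : reflect (totally_positive (val a)) (a \in posInt K).
Proof. by apply: (iffP idP); rewrite inE. Qed.

Lemma totally_nonnegD x y :
  totally_nonneg x -> totally_nonneg y -> totally_nonneg (x + y).
Proof. by move=> hx hy s; rewrite rmorphD addr_ge0. Qed.

Lemma totally_nonnegM x y :
  totally_nonneg x -> totally_nonneg y -> totally_nonneg (x * y).
Proof. by move=> hx hy s; rewrite rmorphM mulr_ge0. Qed.

Lemma totally_nonneg_sqr (x : K) : totally_nonneg (x ^+ 2).
Proof. by move=> s; rewrite rmorphXn /= real_exprn_even_ge0. Qed.

Lemma totally_nonneg_sum (I : finType) (P : pred I) (f : I -> K) :
  (forall i, P i -> totally_nonneg (f i)) -> totally_nonneg (\sum_(i | P i) f i).
Proof. by move=> h s; rewrite rmorph_sum sumr_ge0 // => i Pi; apply: h. Qed.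

Lemma totally_positiveW x : totally_positive x -> totally_nonneg x.
Proof. by move=> h s; apply: ltW. Qed.

Lemma totally_nonneg_pos x : x != 0 -> totally_nonneg x -> totally_positive x.
Proof. by move=> x0 h s; rewrite lt0r h fmorph_eq0 x0. Qed.

Lemma totally_positiveD x y :
  totally_positive x -> totally_nonneg y -> totally_positive (x + y).
Proof. by move=> hx hy s; rewrite rmorphD ltr_pwDl. Qed.

Lemma totally_positiveM (x y : K) :
  totally_positive x -> totally_positive y -> totally_positive (x * y).
Proof. by move=> hx hy s; rewrite rmorphM mulr_gt0. Qed.

Lemma totally_positive1 : totally_positive (1 : K).
Proof. by move=> s; rewrite rmorph1. Qed.

(** Eight times this element is [(4 x + 1) ^ 2 + 15]. For integral [x] it is a totally positive
    integer congruent to [x] modulo 2. *)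
Lemma totally_positive_quad (x : K) : totally_positive (2 * x ^+ 2 + x + 2).
Proof.
move=> s; rewrite -(@pmulr_rgt0 _ 8) //.
have -> : 8 * s (2 * x ^+ 2 + x + 2) = s ((4 * x + 1) ^+ 2) + 15.
  by rewrite !(rmorphD, rmorphM, rmorphXn, rmorph1, rmorph_nat) /=; ring.
by rewrite ltr_wpDl // totally_nonneg_sqr.
Qed.

Variables (n : nat) (s : 'I_n.+1 -> {rmorphism K -> algC}).
Hypothesis s_rat : forall x, \sum_i s i x \in Crat /\ \prod_i s i x \in Crat.

(** The truncation is exact on totally nonnegative integers, whose trace is a natural number. *)
Definition ntr (x : OK) : nat := Num.truncn (\sum_i s i (val x)).

Lemma ntrE (x : OK) : totally_nonneg (val x) -> (ntr x)%:R = \sum_i s i (val x).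
Proof.
move=> hx; rewrite /ntr truncnK // natrEint sumr_ge0 // andbT.
apply: Cint_rat_Aint; first by case: (s_rat (val x)).
by apply: rpred_sum => i _; apply: alg_int_Aint.
Qed.

Lemma ntrD (x y : OK) : totally_nonneg (val x) -> totally_nonneg (val y) ->
  ntr (x + y) = (ntr x + ntr y)%N.
Proof.
move=> hx hy; apply/eqP; rewrite -(eqr_nat algC) natrD !ntrE //.
  by rewrite -big_split /=; apply/eqP/eq_bigr => i _; rewrite !rmorphD.
by rewrite rmorphD; apply: totally_nonnegD.
Qed.

Lemma ntr1 : ntr 1 = n.+1.
Proof.
apply/eqP; rewrite -(eqr_nat algC) ntrE; last by move=> t; rewrite !rmorph1.
by under eq_bigr do rewrite !rmorph1; rewrite sumr_const card_ord.
Qed.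

(** A positive rational algebraic integer is a natural number, hence at least 1. *)
Lemma norm_ge1 (x : OK) : totally_positive (val x) -> 1 <= \prod_i s i (val x).
Proof.
move=> hx; have p0 : 0 < \prod_i s i (val x) by apply: prodr_gt0.
have : \prod_i s i (val x) \in Num.nat.
  rewrite natrEint (ltW p0) andbT; apply: Cint_rat_Aint; first by case: (s_rat (val x)).
  by apply: rpred_prod => i _; apply: alg_int_Aint.
by case/natrP => k kE; rewrite kE in p0 *; rewrite ler1n -(ltr0n algC).
Qed.

(* AM-GM on the conjugates, whose product is at least 1. *)
Lemma ntr_ge (x : OK) : totally_positive (val x) ->
  (n.+1 <= ntr x)%N /\ (ntr x = n.+1 -> val x \in 1%VS).
Proof.
move=> hx; have h0 := totally_positiveW hx.
have := @leif_AGM algC 'I_n.+1 predT (fun i => s i (val x)).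
rewrite card_ord -ntrE // => -[i _|le eqE]; first exact: h0.
set mu := _ / _ in le eqE.
have mu0 : 0 <= mu by rewrite divr_ge0.
have le1 := le_trans (norm_ge1 hx) le; split=> [|e].
  move: le1; rewrite -[1](expr1n _ n.+1) ler_pXn2r ?nnegrE // ler_pdivlMr ?ltr0n //.
  by rewrite mul1r ler_nat.
have mu1 : mu = 1 by rewrite /mu e divff // pnatr_eq0.
move: eqE le; rewrite mu1 expr1n => eqE le.
(* Equality in AM-GM makes all conjugates equal; their mean being 1, each is 1. *)
move: eqE; rewrite eq_le le norm_ge1 //= => /esym/forallP/(_ ord0)/forallP /= E.
have Es : s ord0 (val x) = 1.
  have S := ntrE h0; rewrite e (eq_bigr (fun=> s ord0 (val x))) in S; last first.
    by move=> i _; have /eqP := E i.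
  apply: (@mulfI _ n.+1%:R); first by rewrite pnatr_eq0.
  by rewrite mulr1 [RHS]S sumr_const card_ord mulr_natl.
have -> : val x = 1 by apply: (fmorph_inj (s ord0)); rewrite Es rmorph1.
exact: mem1v.
Qed.

End Positivity.

(** * Integers modulo 2 *)
Section ReducedMod2.
Variable K : fieldExtType rat.
Local Notation OK := (ringInt K).

(** The rational minimal polynomial of a conjugate of [r] will do: it is integral because the
    conjugate is an algebraic integer, and its degree is at most that of [K]. *)
Lemma alg_int_monic_poly (r : OK) : exists p : {poly int},
  [/\ p \is monic, (size p <= (\dim {:K}).+1)%N & root (map_poly intr p) r].
Proof.
have [n [s _]] := embeddings_exist K; pose s0 := s ord0.
have := alg_int_Aint s0 r; rewrite unfold_in.
have [q [Dq q_monic] q_dvd] := minCpolyP (s0 (val r)).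
move/floorpP => [p Dp]; exists p.
have p_monic : p \is monic.
  have := minCpoly_monic (s0 (val r)); rewrite Dp => /monicP.
  rewrite lead_coef_map_inj ?rmorph0 //; last exact: intr_inj.
  by rewrite -[1](rmorph1 intr) => /intr_inj/monicP.
split=> //.
  have /polyOver1P [mu Dmu] := minPolyOver 1 (val r).
  have : q %| mu.
    rewrite -q_dvd; have : root (map_poly s0 (minPoly 1 (val r))) (s0 (val r)).
      by rewrite fmorph_root root_minPoly.
    rewrite Dmu -map_poly_comp; congr (root _ _); apply: eq_map_poly => a /=.
    by rewrite alg_num_field fmorph_rat.
  have mu0 : mu != 0 by rewrite -(map_poly_eq0 (in_alg K)) -Dmu monic_neq0 ?monic_minPoly.
  move/(dvdp_leq mu0); have -> : size mu = (adjoin_degree 1 (val r)).+1.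
    by rewrite -size_minPoly Dmu size_map_poly.
  have -> : size q = size p.
    rewrite -(size_map_poly (ratr : {rmorphism rat -> algC})) -Dq Dp.
    by rewrite size_map_poly_id0 // (monicP p_monic) rmorph1 oner_eq0.
  move/leq_trans; apply; rewrite ltnS.
  have := dim_Fadjoin 1 (val r); rewrite dimv1 muln1 => <-.
  exact: dimvS (subvf _).
pose f : {rmorphism OK -> algC} := s0 \o (val : OK -> K).
have f_inj : injective f by move=> u v /fmorph_inj/val_inj.
apply/rootP/f_inj; rewrite rmorph0 -horner_map -map_poly_comp.
rewrite (@eq_map_poly _ _ _ intr); last by move=> a; apply: (rmorph_int f).
by rewrite -Dp; apply/rootP; apply: root_minCpoly.
Qed.

(** Let [j] be the least index of an odd coefficient of a monic integer polynomial killing [r].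
    Modulo 2 the equation makes [r ^ j] a multiple of [r ^ j.+1], hence by iteration of
    [r ^ (j + N)], which is even; and [j] is at most the degree of [K]. *)
Lemma even_pow (r c : OK) (N : nat) : r ^+ N = 2 * c ->
  exists e, r ^+ \dim {:K} = 2 * e.
Proof.
move=> rN; have [p [p_monic sz_p /rootP pr0]] := alg_int_monic_poly r.
have exj : exists j, ~~ (2 %| p`_j)%Z.
  by exists (size p).-1; rewrite -lead_coefE (monicP p_monic).
case: (ex_minnP exj) => j oddj jmin.
have jsz : (j < size p)%N by rewrite ltnNge; apply: contra oddj => /leq_sizeP ->.
have [a [b Eab]] : exists a b, r ^+ j = r ^+ j.+1 * a + 2 * b.
  move: pr0; rewrite horner_coef size_map_poly_id0; last first.
    by rewrite (monicP p_monic) rmorph1 oner_eq0.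
  rewrite (bigD1 (Ordinal jsz)) //= coef_map /=.
  have [k ->] : exists k, p`_j = 2 * k + 1.
    by exists (p`_j %/ 2)%Z; move: oddj; lia.
  have : exists a b, \sum_(i < size p | i != Ordinal jsz) (map_poly intr p)`_i * r ^+ i
      = r ^+ j.+1 * a + 2 * b.
    apply: (big_ind (fun y : OK => exists a b, y = r ^+ j.+1 * a + 2 * b)).
    - by exists 0, 0; ring.
    - by move=> _ _ [a [b ->]] [a' [b' ->]]; exists (a + a'), (b + b'); ring.
    move=> i ij; rewrite coef_map /=.
    have [lt|ge] := ltnP i j.
      have : (2 %| p`_i)%Z by apply: contraLR lt => /jmin; rewrite -leqNgt.
      case/dvdzP => q ->; exists 0, (q%:~R * r ^+ i); rewrite rmorphM /=; ring.
    have lt : (j < i)%N by rewrite ltn_neqAle ge andbT eq_sym.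
    exists ((p`_i)%:~R * r ^+ (i - j.+1)), 0.
    have -> : r ^+ i = r ^+ j.+1 * r ^+ (i - j.+1) by rewrite -exprD subnKC.
    by move: (r ^+ j.+1) (r ^+ (i - j.+1)) => u v; ring.
  case=> a [b ->] H; exists (- a), (- b - k%:~R * r ^+ j).
  apply/eqP; rewrite -subr_eq0 -H rmorphD rmorphM /=; apply/eqP; ring.
have iter k : exists a b, r ^+ j = r ^+ (j + k) * a + 2 * b.
  elim: k => [|k [a' [b' E']]]; first by exists 1, 0; rewrite addn0; ring.
  exists (a * a'), (b' + r ^+ k * b * a'); rewrite {1}E' exprD Eab addnS -addSn exprD;
    ring.
have [a' [b' E']] := iter N.
have jd : (j <= \dim {:K})%N by rewrite -ltnS (leq_trans jsz).
move: (\dim {:K}) jd => D jd; exists (r ^+ (D - j) * (r ^+ j * c * a' + b')).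
have -> : r ^+ D = r ^+ (D - j) * r ^+ j by rewrite -exprD subnK.
rewrite [in LHS]E' exprD rN; move: (r ^+ (D - j)) (r ^+ j) => u v; ring.
Qed.

(* Every class modulo 2 is a 2^k-th power; for k large this forces a class of
   square zero to vanish. *)
Lemma even_sqr : (forall x : OK, exists u w, x = u ^+ 2 + 2 * w) ->
  forall t c : OK, t ^+ 2 = 2 * c -> exists e, t = 2 * e.
Proof.
move=> sq_mod2 t c tc.
have powE k (x : OK) : exists u w, x = u ^+ (2 ^ k) + 2 * w.
  elim: k x => [|k IH] x; first by exists x, 0; rewrite mulr0 addr0.
  have [v [w ->]] := sq_mod2 x; have [u [w' ->]] := IH v.
  exists u, (w + 2 * u ^+ (2 ^ k) * w' + 2 * w' ^+ 2).
  by rewrite expnSr exprM; move: (u ^+ (2 ^ k)) => u'; ring.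
have even_powD := @even_pow; move: (\dim {:K}) even_powD => D even_powD.
have [r [w Dt]] := powE D t.
(* Modulo 2, [t] is [r ^ (2 ^ D)] and [t ^ 2] vanishes, so [r] is nilpotent. Then [r ^ D] is even,
   and so is [t] because [D <= 2 ^ D]. *)
have [c' /even_powD [e re]] : exists c', r ^+ (2 ^ D * 2) = 2 * c'.
  exists (c - 2 * r ^+ (2 ^ D) * w - 2 * w ^+ 2).
  by rewrite !mulrBr -tc Dt exprM; move: (r ^+ (2 ^ D)) => u; ring.
exists (r ^+ (2 ^ D - D) * e + w).
have -> : t = r ^+ (2 ^ D - D) * r ^+ D + 2 * w.
  by rewrite -exprD subnK // ltnW // ltn_expl.
by rewrite re; move: (r ^+ (2 ^ D - D)) => u; ring.
Qed.

End ReducedMod2.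

(** * Non-universal diagonal forms *)
Section NotUniversal.
Variables (K : fieldExtType rat) (F : {subfield K}).
Hypothesis K_real : totally_real K.
Local Notation OK := (ringInt K).

(* If [q] is the minimal polynomial of [x] and [a q] has integer coefficients
   then [a x] is a root of the monic polynomial with coefficients
   [q_i a^(n-i)]. *)
Lemma alg_int_multiple (x : K) : exists2 k : nat, (0 < k)%N & is_alg_int (k%:R * x).
Proof.
have /polyOver1P [q Dq] := minPolyOver 1 x.
have q_monic : q \is monic by rewrite -(map_monic (in_alg K)) -Dq monic_minPoly.
have [p [a a0 Dp]] := rat_poly_scale q.
have qx0 : \sum_(i < size q) (q`_i)%:A * x ^+ i = 0.
  have := minPolyxx 1 x; rewrite Dq horner_coef size_map_poly => H.
  by rewrite -[RHS]H; apply: eq_bigr => i _; rewrite coef_map.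
have q_gt0 : (0 < size q)%N by rewrite size_poly_gt0 monic_neq0.
pose n := (size q).-1; have Dn : size q = n.+1 by rewrite /n prednK.
pose p' : {poly K} := \poly_(i < n.+1) ((q`_i)%:A * a%:~R ^+ (n - i)).
have p'n : p'`_n = 1.
  by rewrite coef_poly ltnSn subnn mulr1 -lead_coefE (monicP q_monic) scale1r.
have p'_monic : p' \is monic.
  rewrite monicE lead_coefE.
  suff -> : size p' = n.+1 by rewrite p'n.
  apply/eqP; rewrite eqn_leq size_poly ltnNge; apply/negP => /leq_sizeP/(_ n (leqnn _)).
  by move/eqP; rewrite p'n oner_eq0.
have iax : is_alg_int (a%:~R * x).
  apply/asboolP/(integral_root_monic p'_monic); first last.
    move=> _ /(nthP 0) [i _ <-]; suff: p'`_i \in @is_alg_int K by move/asboolP.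
    have [lt|ge] := ltnP i n; last first.
      have [->|ne] := eqVneq i n; first by rewrite p'n; apply: rpred1.
      rewrite coef_poly ltnS leqNgt ltn_neqAle ge eq_sym ne; exact: rpred0.
    rewrite coef_poly ltnS ltnW // -(subnSK lt) exprS mulrA.
    have -> : (q`_i)%:A * a%:~R = (p`_i)%:~R :> K.
      have -> : a%:~R = in_alg K a%:~R by rewrite rmorph_int.
      rewrite -[_%:A]/(in_alg K _) -rmorphM Dp coefZ coef_map /=.
      by rewrite mulrAC mulVf ?intr_eq0 // mul1r -[_%:A]/(in_alg K _) rmorph_int.
    by rewrite rpredM ?rpredX ?rpred_int.
  apply/rootP; rewrite horner_poly.
  transitivity (a%:~R ^+ n * \sum_(i < size q) (q`_i)%:A * x ^+ i);
    last by rewrite qx0 mulr0.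
  rewrite Dn mulr_sumr; apply: eq_bigr => i _.
  have -> : a%:~R ^+ n = a%:~R ^+ (n - i) * a%:~R ^+ i :> K.
    by rewrite -exprD subnK // -ltnS.
  by rewrite exprMn; ring.
exists `|a|%N; first by rewrite absz_gt0.
change (`|a|%:R * x \in @is_alg_int K).
rewrite -[`|a|%:R]/((`|a|%:Z)%:~R) abszE; have [_|_] := ger0P a; first exact: iax.
by rewrite rmorphN mulNr rpredN.
Qed.

Lemma natr_neq0 k : (0 < k)%N -> k%:R != 0 :> K.
Proof.
have -> : k%:R = in_alg K k%:R by rewrite rmorph_nat.
by rewrite fmorph_eq0 pnatr_eq0 -lt0n.
Qed.

(** For an integer [y] outside [F], the squares [y ^ 2] and [(y + 1) ^ 2] cannot both lie in [F],
    their difference being [2 y + 1]. *)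
Lemma posInt_outside : (F : {vspace K}) <> fullv ->
  exists2 a : OK, a \in posInt K & val a \notin F.
Proof.
move=> F_proper; have [x Fx] : exists x, x \notin F.
  apply: contrapT => H; apply: F_proper; apply/vspaceP => x; rewrite memvf.
  by apply: contrapT => /negP Fx; apply: H; exists x.
have [k k0 ikx] := alg_int_multiple x.
pose y : OK := RingInt ikx.
have Fy : val y \notin F.
  apply: contra Fx => Fy; rewrite -(mulKf (natr_neq0 k0) x).
  by rewrite rpredM // rpredV rpred_nat.
have sqr_pos (z : OK) : val z \notin F -> z ^+ 2 \in posInt K.
  move=> Fz; apply/posIntP/totally_nonneg_pos.
    by rewrite rmorphXn expf_neq0 //; apply: contraNneq Fz => ->; rewrite mem0v.
  by rewrite rmorphXn; apply: totally_nonneg_sqr.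
have [Fy2|Fy2] := boolP (val (y ^+ 2) \in F); last by exists (y ^+ 2) => //;
  apply: sqr_pos.
have Fy1 : val (y + 1) \notin F by rewrite rmorphD rmorph1 rpredDr ?rpred1.
exists ((y + 1) ^+ 2); first exact: sqr_pos.
rewrite sqrrD1 !rmorphD rmorph1 rpredDr ?rpred1 // rpredDl //.
apply: contra Fy => F2y; rewrite -(mulKf (natr_neq0 (ltn0Sn 1)) (val y)).
by rewrite mulr_natl [val y *+ 2]mulr2n; apply: rpredM; [rewrite rpredV;
  apply: rpred_nat | exact: F2y].
Qed.

(** The splitting in [F] makes every term but the first costly in trace; the squares modulo 2 carry
    over from the coefficients to all values of the form. *)
Lemma diag_not_universal (n : nat) (a : 'rV[OK]_n.+1) :
  (F : {vspace K}) <> fullv -> a 0 0 = 1 ->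
  (forall i, i != 0 -> exists b c, [/\ b \in posInt K, c \in posInt K,
     val b \in F, val c \in F & a 0 i = b + c]) ->
  (forall i, exists u w, a 0 i = u ^+ 2 + 2 * w) ->
  ~ (forall x, x \in posInt K -> exists v, diag_form a v = x).
Proof.
move=> F_proper a0 a_split a_sq univ.
have [d [s s_rat]] := embeddings_exist K.
pose tr := ntr s.
have trD x y : totally_nonneg (val x) -> totally_nonneg (val y) ->
  tr (x + y) = (tr x + tr y)%N by apply: ntrD.
have tr_ge x : totally_positive (val x) -> (d < tr x)%N.
  by case/(ntr_ge s_rat).
have pos_neq0 (x : OK) : x != 0 -> totally_nonneg (val x) -> totally_positive (val x).
  move=> x0; apply: totally_nonneg_pos; apply: contraNneq x0 => E.
  by apply/eqP/val_inj; rewrite E rmorph0.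
have sqr_nn (x : OK) : totally_nonneg (val (x ^+ 2)).
  by rewrite rmorphXn; apply: totally_nonneg_sqr.
pose P m := `[< exists x : OK, [/\ totally_positive (val x), val x \notin F & tr x = m] >].
have exP : exists m, P m.
  have [x /posIntP px Fx] := posInt_outside F_proper.
  by exists (tr x); apply/asboolP; exists x.
case: (ex_minnP exP) => m /asboolP [x [px Fx trx]] m_min.
have tr_min y : totally_nonneg (val y) -> val y \notin F -> (m <= tr y)%N.
  move=> py Fy; apply: m_min; apply/asboolP; exists y; split=> //.
  by apply: totally_nonneg_pos => //; apply: contraNneq Fy => ->; rewrite mem0v.
(* [d.+1] is the trace of 1; equality would put [x] in the rationals, hence in [F]. *)
have m_gt : (d.+1 < m)%N.
  have [ge eq] := ntr_ge s_rat px; rewrite -trx ltn_neqAle ge andbT eq_sym.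
  by apply: contra Fx => /eqP /eq; apply: (subvP (sub1v F)).
have two_neq0 : (2 : OK) != 0.
  by apply: contraNneq (natr_neq0 (ltn0Sn 1)) => E;
    rewrite -(rmorph_nat (val : OK -> K)) E rmorph0.
have a_nn i : totally_nonneg (val (a 0 i)).
  have [->|/a_split [b [c [/posIntP pb /posIntP pc _ _ ->]]]] := eqVneq i 0.
    by rewrite a0 rmorph1; apply/totally_positiveW/totally_positive1.
  by rewrite rmorphD; apply: totally_nonnegD; apply: totally_positiveW.
have term_nn (v : 'rV[OK]_n.+1) i : totally_nonneg (val (a 0 i * v 0 i ^+ 2)).
  by rewrite rmorphM; apply: totally_nonnegM; [apply: a_nn | apply: sqr_nn].
(* The bound is the trace of [x + 1], so that both [x] and [x + 1] are covered. *)
have small_sqr y : totally_nonneg (val y) -> val y \notin F ->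
    (tr y <= m + d.+1)%N -> exists z, y = z ^+ 2.
  move=> py Fy try.
  have [v Dy] : exists v, diag_form a v = y.
    apply: univ; apply/posIntP/totally_nonneg_pos => //.
    by apply: contraNneq Fy => ->; rewrite mem0v.
  (* The term is the sum of [b * v 0 i ^+ 2] and [c * v 0 i ^+ 2], each of trace at least [d.+1]. If
     [v 0 i ^+ 2] were outside [F], each would have trace at least [m], but [2 m > m + d.+1]. *)
  have tr_term i z : y = a 0 i * v 0 i ^+ 2 + z -> totally_nonneg (val z) -> i != 0 ->
      v 0 i != 0 -> val (v 0 i ^+ 2) \in F /\ (2 * d.+1 <= tr y - tr z)%N.
    move=> Ey pz i0 vi0; have [b [c [/posIntP pb /posIntP pc Fb Fc Ea]]] := a_split i i0.
    have pv : totally_positive (val (v 0 i ^+ 2)).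
      by apply: pos_neq0 => //; rewrite expf_neq0.
    have pbv : totally_positive (val (b * v 0 i ^+ 2)).
      by rewrite rmorphM; apply: totally_positiveM.
    have pcv : totally_positive (val (c * v 0 i ^+ 2)).
      by rewrite rmorphM; apply: totally_positiveM.
    have Etr : tr y = (tr (b * v 0 i ^+ 2)%R + tr (c * v 0 i ^+ 2)%R + tr z)%N.
      rewrite Ey Ea mulrDl !trD //; try exact: totally_positiveW.
      by rewrite rmorphD; apply: totally_nonnegD; apply: totally_positiveW.
    split; last by have := tr_ge _ pbv; have := tr_ge _ pcv; lia.
    apply/negPn/negP => Fv.
    have out (e : OK) : totally_positive (val e) -> val e \in F ->
      val (e * v 0 i ^+ 2) \notin F.
      move=> pe Fe; apply: contra Fv => Fev.
      have e0 : val e != 0.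
        by apply/eqP => E; have := pe (s ord0); rewrite E rmorph0 ltxx.
      by rewrite -[val _](mulKf e0) -rmorphM rpredM ?rpredV.
    have := tr_min _ (totally_positiveW pbv) (out b pb Fb).
    have := tr_min _ (totally_positiveW pcv) (out c pc Fc).
    by lia.
  pose R := \sum_(i < n.+1 | i != 0) a 0 i * v 0 i ^+ 2.
  have Ey : y = v 0 0 ^+ 2 + R.
    by rewrite -Dy /diag_form (bigD1 0) //= a0 mul1r.
  have nn_sum (Q : pred 'I_n.+1) : totally_nonneg (val (\sum_(i | Q i) a 0 i * v 0 i ^+ 2)).
    by rewrite rmorph_sum; apply: totally_nonneg_sum => i _; apply: term_nn.
  have other i : i != 0 -> exists2 z, y = a 0 i * v 0 i ^+ 2 + z & totally_nonneg (val z).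
    by move=> i0; exists (\sum_(j | j != i) a 0 j * v 0 j ^+ 2);
      rewrite // -Dy /diag_form (bigD1 i).
  have FR : val R \in F.
    rewrite rmorph_sum; apply: rpred_sum => i i0; rewrite rmorphM.
    have [->|vi0] := eqVneq (v 0 i) 0; first by rewrite expr0n rmorph0 mulr0 mem0v.
    have [z Ez pz] := other i i0; have [Fv _] := tr_term i z Ez pz i0 vi0.
    have [b [c [_ _ Fb Fc ->]]] := a_split i i0.
    by rewrite rpredM // rmorphD rpredD.
  have Fv0 : val (v 0 0 ^+ 2) \notin F.
    by apply: contra Fy => Fv; rewrite Ey rmorphD rpredD.
  (* The first square lies outside [F] and takes up trace at least [m]. What is left is below the
     [2 * d.+1] that a nonzero term of [R] needs. *)
  have trR : (tr R <= d.+1)%N.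
    have := tr_min _ (sqr_nn _) Fv0; have := trD _ _ (sqr_nn (v 0 0)) (nn_sum (fun i => i != 0)).
    by rewrite -/R -Ey; lia.
  exists (v 0 0); rewrite Ey /R big1 ?addr0 // => i i0.
  have [->|vi0] := eqVneq (v 0 i) 0; first by rewrite expr0n mulr0.
  have ER : R = a 0 i * v 0 i ^+ 2 + \sum_(j | (j != 0) && (j != i)) a 0 j * v 0 j ^+ 2.
    by rewrite /R (bigD1 i).
  set S := \sum_(j | _) _ in ER.
  have Ey' : y = a 0 i * v 0 i ^+ 2 + (v 0 0 ^+ 2 + S) by rewrite Ey ER; ring.
  have pS : totally_nonneg (val (v 0 0 ^+ 2 + S)).
    by rewrite rmorphD; apply: totally_nonnegD; [apply: sqr_nn | apply: nn_sum].
  have [_] := tr_term i _ Ey' pS i0 vi0; rewrite {1}Ey' (trD _ _ (term_nn _ _) pS).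
  move: trR; rewrite ER (trD _ _ (term_nn _ _)); first by lia.
  exact: nn_sum.
have x_nn := totally_positiveW px.
have [r Dx] : exists r, x = r ^+ 2 by apply: small_sqr; rewrite ?trx ?leq_addr.
have [z Dz] : exists z, x + 1 = z ^+ 2.
  have nn1 : totally_nonneg (val (1 : OK)).
    by rewrite rmorph1; apply/totally_positiveW/totally_positive1.
  apply: small_sqr; first by rewrite rmorphD; apply: totally_nonnegD.
    by rewrite rmorphD rmorph1 rpredDr ?rpred1.
  by rewrite trD // trx /tr ntr1.
(* Universality is applied to a totally positive integer congruent to [y]; squares modulo 2 are
   closed under addition. *)
have sq_mod2 (y : OK) : exists u w, y = u ^+ 2 + 2 * w.
  have [v Dv] : exists v, diag_form a v = 2 * y ^+ 2 + y + 2.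
    apply: univ; apply/posIntP.
    by rewrite !(rmorphD, rmorphM, rmorphXn, rmorph_nat); apply: totally_positive_quad.
  have [u [w Duw]] : exists u w, diag_form a v = u ^+ 2 + 2 * w.
    apply: (big_ind (fun e : OK => exists u w, e = u ^+ 2 + 2 * w)).
    - by exists 0, 0; ring.
    - move=> _ _ [u [w ->]] [u' [w' ->]]; exists (u + u'), (w + w' - u * u'); ring.
    move=> i _; have [u [w ->]] := a_sq i; exists (u * v 0 i), (w * v 0 i ^+ 2); ring.
  exists u, (w - y ^+ 2 - 1); apply/eqP; rewrite -subr_eq0; apply/eqP.
  have -> : u ^+ 2 = 2 * y ^+ 2 + y + 2 - 2 * w by rewrite -Dv Duw; ring.
  ring.
have [e De] : exists e, z - r - 1 = 2 * e.
  apply: (even_sqr sq_mod2 (c := z ^+ 2 - z * r - z + r)).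
  have -> : 2 * (z ^+ 2 - z * r - z + r) = z ^+ 2 + (x + 1) - 2 * z * r - 2 * z + 2 * r.
    by rewrite Dz; ring.
  by rewrite Dx; ring.
(* Expanding [(r + 1 + 2 e) ^ 2 = r ^ 2 + 1] gives [2 r = - 4 (e r + e + e ^ 2)]. *)
pose r' := - (e * r + e + e ^+ 2).
have Dr : r = 2 * r'.
  apply: (@mulfI _ (2 : OK)); first exact: two_neq0.
  have : z ^+ 2 - x - 1 = 0 by rewrite -Dz; ring.
  have -> : z = r + 1 + 2 * e by rewrite -De; ring.
  rewrite Dx /r' => H; apply/eqP; rewrite -subr_eq0 -H; apply/eqP; ring.
have Ex : x = r' ^+ 2 + r' ^+ 2 + (r' ^+ 2 + r' ^+ 2) by rewrite Dx Dr; ring.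
have Fr' : val (r' ^+ 2) \notin F.
  by apply: contra Fx => Fr'; rewrite Ex !rmorphD !rpredD.
have nn2 : totally_nonneg (val (r' ^+ 2 + r' ^+ 2)).
  by rewrite rmorphD; apply: totally_nonnegD; apply: sqr_nn.
have := tr_min _ (sqr_nn r') Fr'; move: m_gt; rewrite -trx Ex.
by rewrite (trD _ _ nn2 nn2) (trD _ _ (sqr_nn r') (sqr_nn r')); lia.
Qed.

End NotUniversal.
(** * Representing the integers of Q and of Q(sqrt 5) *)
Section Representation.
Variable R : comNzRingType.

(** Over [Z[phi]] the block [v] absorbs the even part of the coefficient of 1, and the block [w],
    multiplied by [phi], that of the coefficient of [phi ^ 2]. *)
Definition represented (rho x : R) : Prop := exists y z : R, exists v w : 'I_4 -> R,
  x = y ^+ 2 + rho * z ^+ 2 + 2 * (\sum_i v i ^+ 2 + \sum_i w i ^+ 2).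

Lemma sum_sqrM (I : finType) (u : R) (v : I -> R) :
  \sum_i (u * v i) ^+ 2 = u ^+ 2 * \sum_i v i ^+ 2.
Proof. by rewrite mulr_sumr; apply: eq_bigr => i _; rewrite exprMn. Qed.

Lemma natr_four_squares (n : nat) : exists v : 'I_4 -> R, n%:R = \sum_i v i ^+ 2.
Proof.
have [a [b [c [d E]]]] := four_squares_nat n.
exists (fun i => (nth 0 [:: a; b; c; d] i)%:~R).
rewrite !big_ord_recl big_ord0 /= -[n%:R]/(n%:Z%:~R) E.
by rewrite !rmorphD !rmorphXn /=; ring.
Qed.

Lemma represented_nat (rho : R) (n : nat) : represented rho n%:R.
Proof.
have [v Ev] := natr_four_squares n./2.
exists (odd n)%:R, 0, v, (fun=> 0).
rewrite -Ev [in X in _ + X]big1 => [|i _]; last by rewrite expr0n.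
rewrite -{1}(odd_double_half n) natrD -mul2n natrM.
by case: (odd n); rewrite /=; ring.
Qed.

Variable phi : R.
Hypothesis phiE : phi ^+ 2 = phi + 1.

(** Given the cofactor [c], an equality modulo the relation of [phi] becomes a polynomial identity,
    within reach of [ring]. *)
Lemma golden_eq (x y c : R) : x - y = c * (phi ^+ 2 - (phi + 1)) -> x = y.
Proof. by rewrite phiE subrr mulr0 => /eqP; rewrite subr_eq0 => /eqP. Qed.

Lemma represented_unit (u x : R) : represented (phi + 2) x ->
  represented (phi + 2) (u ^+ 2 * x).
Proof.
move=> [y [z [v [w ->]]]].
exists (u * y), (u * z), (fun i => u * v i), (fun i => u * w i).
by rewrite !sum_sqrM; ring.
Qed.

Lemma represented_golden_nat (a b : nat) :
  represented (phi + 2) (a%:R + b%:R * phi ^+ 2).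
Proof.
have [v Ev] := natr_four_squares a./2; have [w Ew] := natr_four_squares b./2.
suff [y [z E]] : exists y z : R,
    (odd a)%:R + (odd b)%:R * phi ^+ 2 = y ^+ 2 + (phi + 2) * z ^+ 2.
  exists y, z, v, (fun i => phi * w i); rewrite -Ev -E.
  rewrite sum_sqrM -Ew -{1}(odd_double_half a) -{1}(odd_double_half b).
  by rewrite !natrD -!mul2n !natrM; ring.
(* When both are odd, [1 + phi ^ 2] is the coefficient [phi + 2] itself. *)
case: (odd a); case: (odd b) => /=.
- by exists 0, 1; rewrite phiE; ring.
- by exists 1, 0; ring.
- by exists phi, 0; ring.
- by exists 0, 0; ring.
Qed.

(* Multiplying by [phi ^ 2] or [phi ^ -2] lowers the trace [2 a + 3 b] unless
   both coordinates are nonnegative. *)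
Lemma represented_golden (a b : int) : 0 < 2 * a + 3 * b ->
  0 < a ^+ 2 + 3 * a * b + b ^+ 2 ->
  represented (phi + 2) (a%:~R + b%:~R * phi ^+ 2).
Proof.
(* The two hypotheses are positivity of the trace and of the norm of [a + b phi ^ 2]; squares of
   units preserve the norm. *)
have [t] := ubnP `|(2 * a + 3 * b)%R|%N.
elim: t a b => [|t IH] a b // le_t tr_gt0 nm_gt0.
have [a_ge0|a_lt0] := leP 0 a; last first.
  have b_gt0 : 0 < b by lia.
  have -> : a%:~R + b%:~R * phi ^+ 2
      = phi ^+ 2 * ((3 * a + b)%:~R + (- a)%:~R * phi ^+ 2) :> R.
    rewrite !(rmorphD, rmorphM, rmorphN) /=.
    apply: (golden_eq (c := a%:~R * (phi ^+ 2 + phi - 1))); ring.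
  (* Were the new trace nonpositive, the identity [E] would make the norm negative, since
     [a * b < 0]. *)
  have tr' : 0 < 3 * a + 2 * b.
    rewrite ltNge; apply/negP => h.
    have h1 : (2 * a + 3 * b) * (3 * a + 2 * b) <= 0 by rewrite pmulr_rle0.
    have h2 : a * b < 0 by rewrite nmulr_rlt0.
    have E : 6 * (a ^+ 2 + 3 * a * b + b ^+ 2)
      = (2 * a + 3 * b) * (3 * a + 2 * b) + 5 * (a * b) by ring.
    by move: nm_gt0 h1 h2 E; move: (_ + b ^+ 2) (a * b) (_ * (_ + _)); lia.
  apply: represented_unit; apply: IH; [lia|lia|].
  by have -> : (3 * a + b) ^+ 2 + 3 * (3 * a + b) * - a + (- a) ^+ 2
    = a ^+ 2 + 3 * a * b + b ^+ 2 by ring.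
have [b_ge0|b_lt0] := leP 0 b.
  by case: a a_ge0 {IH le_t tr_gt0 nm_gt0} => // a _; case: b b_ge0 => // b _;
    apply: represented_golden_nat.
have -> : a%:~R + b%:~R * phi ^+ 2
    = (phi - 1) ^+ 2 * ((- b)%:~R + (a + 3 * b)%:~R * phi ^+ 2) :> R.
  rewrite !(rmorphD, rmorphM, rmorphN) /=.
  apply: (golden_eq (c := 2 * b%:~R - (a%:~R + 3 * b%:~R) * (phi ^+ 2 - phi + 1))); ring.
apply: represented_unit.
have nmE : (- b) ^+ 2 + 3 * (- b) * (a + 3 * b) + (a + 3 * b) ^+ 2
  = a ^+ 2 + 3 * a * b + b ^+ 2 by ring.
(* In the first case both new coordinates are nonnegative and the induction stops; in the second the
   trace drops by [- (a + 4 b) > 0]. *)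
have [c_ge0|c_lt0] := leP 0 (a + 3 * b).
  have -> : - b = `|b|%N by lia.
  have -> : a + 3 * b = `|(a + 3 * b)%R|%N by lia.
  exact: represented_golden_nat.
have tr' : 0 < 3 * a + 7 * b.
  have h : 0 < 3 * a + 2 * b by lia.
  rewrite -(pmulr_lgt0 _ h).
  have -> : (3 * a + 7 * b) * (3 * a + 2 * b)
    = 9 * (a ^+ 2 + 3 * a * b + b ^+ 2) + 5 * b ^+ 2 by ring.
  by apply: ltr_pwDl; [rewrite mulr_gt0 | rewrite mulr_ge0 ?sqr_ge0].
by apply: IH; [lia|lia|rewrite nmE].
Qed.

End Representation.

(** * Diagonal lattices *)
Section DiagonalLattice.
Variables (K : fieldExtType rat) (n : nat) (a : 'rV[ringInt K]_n).
Hypothesis K_real : totally_real K.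
Hypothesis a_pos : forall i, a 0 i \in posInt K.
Local Notation OK := (ringInt K).

Lemma diag_polarE (v w : 'rV[OK]_n) :
  polar (diag_form a) v w = \sum_i val (a 0 i * v 0 i * w 0 i).
Proof.
apply: (@mulIf _ 2%:R); first exact: natr_neq0.
rewrite /polar mulfVK; last exact: natr_neq0.
rewrite /diag_form -!sumrB rmorph_sum mulr_suml; apply: eq_bigr => i _.
by rewrite -(rmorph_nat (val : OK -> K)) -rmorphM !mxE; congr (val _); ring.
Qed.

Fact rV_fin_gen : exists s : seq 'rV[OK]_n, forall v : 'rV[OK]_n,
  exists c : 'I_(size s) -> OK, v = \sum_(i < size s) c i *: s`_i.
Proof.
pose e (i : 'I_n) : 'rV[OK]_n := delta_mx 0 i.
(* [insub] succeeds at every index below [n], so the default 0 never occurs. *)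
exists (mkseq (fun k => if insub k is Some i then e i else 0) n) => v.
rewrite size_mkseq; exists (fun i => v 0 i).
rewrite [LHS]row_sum_delta; apply: eq_bigr => i _.
by rewrite nth_mkseq // valK.
Qed.

Fact rV_torsion_free (c : OK) (v : 'rV[OK]_n) : c *: v = 0 -> c = 0 \/ v = 0.
Proof.
move=> /rowP cv; have [->|c0] := eqVneq c 0; [by left|right; apply/rowP => i].
by have /eqP := cv i; rewrite !mxE mulf_eq0 (negPf c0) => /eqP.
Qed.

Fact diag_formZ (c : OK) (v : 'rV[OK]_n) : diag_form a (c *: v) = c ^+ 2 * diag_form a v.
Proof. by rewrite mulr_sumr; apply: eq_bigr => i _; rewrite mxE; ring. Qed.

Fact diag_polarPl (c : OK) (u v w : 'rV[OK]_n) :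
  polar (diag_form a) (c *: u + v) w =
  val c * polar (diag_form a) u w + polar (diag_form a) v w.
Proof.
rewrite !diag_polarE mulr_sumr -big_split; apply: eq_bigr => i _.
have -> : a 0 i * (c *: u + v) 0 i * w 0 i
    = c * (a 0 i * u 0 i * w 0 i) + a 0 i * v 0 i * w 0 i by rewrite !mxE; ring.
by rewrite rmorphD rmorphM.
Qed.

Fact diag_polarPr (c : OK) (u v w : 'rV[OK]_n) :
  polar (diag_form a) w (c *: u + v) =
  val c * polar (diag_form a) w u + polar (diag_form a) w v.
Proof.
rewrite !diag_polarE mulr_sumr -big_split; apply: eq_bigr => i _.
have -> : a 0 i * w 0 i * (c *: u + v) 0 i
    = c * (a 0 i * w 0 i * u 0 i) + a 0 i * w 0 i * v 0 i by rewrite !mxE; ring.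
by rewrite rmorphD rmorphM.
Qed.

Fact diag_form_pos (v : 'rV[OK]_n) : v != 0 -> diag_form a v \in posInt K.
Proof.
move=> /rV0Pn [i vi0]; apply/posIntP.
rewrite /diag_form (bigD1 i) // rmorphD; apply: totally_positiveD.
  rewrite rmorphM; apply: totally_positiveM; first exact/posIntP.
  rewrite rmorphXn; apply: totally_nonneg_pos; last exact: totally_nonneg_sqr.
  apply: expf_neq0; apply: contraNneq vi0 => v0; apply/eqP/val_inj.
  by rewrite v0 rmorph0.
rewrite rmorph_sum; apply: totally_nonneg_sum => j _; rewrite rmorphM rmorphXn.
apply: totally_nonnegM; last exact: totally_nonneg_sqr.
by apply/totally_positiveW/posIntP.
Qed.

Definition diag_lattice : lattice K :=
  Lattice rV_fin_gen rV_torsion_free diag_formZ diag_polarPl diag_polarPr diag_form_pos.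

(** A single lattice serves every [X], because the polar form of a diagonal form is integral. *)
Lemma diag_lattice_kind (X : lattice_kind) : X_lattice X diag_lattice.
Proof.
case: X => //=.
  move=> v w; rewrite [polar _ _ _]diag_polarE.
  change ((\sum_i val (a 0 i * v 0 i * w 0 i)) \in @is_alg_int K).
  by apply: rpred_sum => i _; apply: valP.
exists n, a, (idfun : {linear 'rV[OK]_n -> 'rV[OK]_n}); split=> //.
by exists id.
Qed.

End DiagonalLattice.

(** A class determines an element up to the square of a unit [u]; scaling the representing vector by
    [u] makes up for it. *)
Lemma not_criterion_set (K : fieldExtType rat) (F : {subfield K}) (X : lattice_kind)
    (L : lattice K) : X_lattice X L ->
  (forall b, b \in posInt (subvs_of F) -> represents L (ringInt_incl b)) ->
  ~ universal L -> ~ criterion_set X (subfield_classes F).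
Proof.
move=> XL repL nuL [_ /(_ L XL) [_ crit]]; apply/nuL/crit => x px [b pb Eb].
have : sq_class (ringInt_incl b) x.
  by rewrite Eb; exists 1; rewrite /= ?unitr1 // expr1n mulr1.
case=> u _ <-; have [|v Dv] := repL b; first by rewrite inE.
by exists (u *: v); rewrite qformZ Dv mulrC.
Qed.

(** * The lattice <1, rho, 2, ..., 2> *)
Section RepresentingLattice.
Variables (K : fieldExtType rat) (F : {subfield K}).
Hypothesis K_real : totally_real K.
Local Notation OK := (ringInt K).

(** The default value of [nth] supplies the last eight coefficients. *)
Definition rho_row (rho : OK) : 'rV[OK]_(2 + (4 + 4)) := \row_i nth 2 [:: 1; rho] i.

Lemma rho_row_represents (rho x : OK) : represented rho x ->
  exists v, diag_form (rho_row rho) v = x.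
Proof.
move=> [y [z [v [w ->]]]].
exists (row_mx (\row_i nth 0 [:: y; z] i) (row_mx (\row_i v i) (\row_i w i))).
rewrite /diag_form (@big_split_ord _ _ _ 2 (4 + 4)) big_split_ord mulrDr !mulr_sumr.
congr (_ + (_ + _)).
- under eq_bigr => i _ do rewrite row_mxEl !mxE.
  by rewrite 2!big_ord_recl big_ord0 /= addr0 mul1r.
- by apply: eq_bigr => i _; rewrite row_mxEr row_mxEl !mxE /= nth_nil.
- by apply: eq_bigr => i _; rewrite !row_mxEr !mxE /=.
Qed.

Lemma not_universal_lattice (X : lattice_kind) (rho b c u w : OK) :
  (F : {vspace K}) <> fullv ->
  b \in posInt K -> c \in posInt K -> val b \in F -> val c \in F -> rho = b + c ->
  rho = u ^+ 2 + 2 * w ->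
  (forall x, x \in posInt (subvs_of F) -> represented rho (ringInt_incl x)) ->
  ~ criterion_set X (subfield_classes F) /\
  exists L : lattice K,
    [/\ X_lattice X L,
        forall x : ringInt (subvs_of F), x \in posInt (subvs_of F) ->
          represents L (ringInt_incl x) &
        ~ universal L].
Proof.
move=> F_proper pb pc Fb Fc Erho Esq rep.
have pos1 : (1 : OK) \in posInt K by apply/posIntP; rewrite rmorph1;
  apply: totally_positive1.
have posD (x y : OK) : x \in posInt K -> y \in posInt K -> x + y \in posInt K.
  move=> /posIntP px /posIntP py; apply/posIntP; rewrite rmorphD.
  by apply/totally_positiveD/totally_positiveW.
have F1 : val (1 : OK) \in F by rewrite rmorph1; apply: rpred1.
have rowE i : rho_row rho 0 i = [:: 1; rho; 2]`_(minn i 2).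
  by rewrite mxE; case: i => [[|[|i]] //= _]; rewrite nth_nil.
have split_row i : i != 0 -> exists b c : OK, [/\ b \in posInt K, c \in posInt K,
     val b \in F, val c \in F & rho_row rho 0 i = b + c].
  rewrite rowE; case: i => [[|[|i]] //= _] _; first by exists b, c.
  by exists 1, 1; split.
have row0 : rho_row rho 0 0 = 1 by rewrite rowE.
have row_pos i : rho_row rho 0 i \in posInt K.
  have [->|/split_row [b' [c' [pb' pc' _ _ ->]]]] := eqVneq i 0; first by rewrite row0.
  exact: posD.
pose L := diag_lattice K_real row_pos.
have repL x : x \in posInt (subvs_of F) -> represents L (ringInt_incl x).
  by move/rep/rho_row_represents.
have nuL : ~ universal L.
  apply: (diag_not_universal K_real F_proper row0 split_row) => i; rewrite rowE.
  case: i => [[|[|i]] _] /=; first by exists 1, 0; ring.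
    by exists u, w.
  by exists 0, 1; ring.
have XL := diag_lattice_kind K_real row_pos X.
by split; [exact: not_criterion_set XL repL nuL | exists L].
Qed.

(** * Totally positive integers of Q and of Q(sqrt 5) in coordinates *)

Lemma pos_rational_nat (x : OK) : x \in posInt K -> val x \in 1%VS ->
  exists n : nat, x = n%:R.
Proof.
move=> /posIntP px /vlineP [q Dq]; have [n [s _]] := embeddings_exist K.
have Es : s ord0 (val x) = ratr q by rewrite Dq alg_num_field fmorph_rat.
have : s ord0 (val x) \in Num.nat.
  rewrite natrEint (ltW (px _)) andbT; apply: Cint_rat_Aint; last exact: alg_int_Aint.
  by rewrite Es Crat_rat.
case/natrP => k Ek; exists k; apply/val_inj/(fmorph_inj (s ord0)).
by rewrite Ek !rmorph_nat.
Qed.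

Lemma Aint_sqr (x : algC) : x ^+ 2 \in Num.int -> x \in Aint.
Proof.
case/intrP => c xc.
have rx : root ('X^2 - c%:~R%:P) x by rewrite rootE !hornerE xc subrr.
apply: (root_monic_Aint rx); first by rewrite monicXnsubC.
apply/polyOverP => i; rewrite coefB coefXn coefC; case: (i == 0)%N => /=.
  by apply: rpredB; [apply: rpred_nat | apply: intr_int].
by rewrite subr0; apply: rpred_nat.
Qed.

Lemma sqr_int_neq5 (z : int) : z ^+ 2 <> 5.
Proof.
move=> E; have : (`|z| ^ 2 = 5)%N by rewrite -abszX E.
by case: `|z|%N => [|[|[|k]]] //; nia.
Qed.

(** If all embeddings agreed at [s], their rational sum would make the common value rational; but a
    rational square root of 5 would be an integer. *)
Lemma conjugate_sqrt5 (s : K) : s ^+ 2 = 5%:R ->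
  exists f g : {rmorphism K -> algC}, g s = - f s /\ f s \notin Crat.
Proof.
move=> s5; have [n [t t_rat]] := embeddings_exist K; pose e := t ord0 s.
have t5 i : t i s ^+ 2 = 5%:R by rewrite -rmorphXn s5 rmorph_nat.
have e_irr : e \notin Crat.
  apply/negP => e_rat.
  have : e \in Num.int.
    by apply: Cint_rat_Aint => //; apply: Aint_sqr; rewrite t5 rpred_nat.
  case/intrP => z Ez; have := t5 ord0; rewrite -/e Ez -rmorphXn -[5%:R]/(5%:~R) => /intr_inj.
  exact: sqr_int_neq5.
have [[i ne]|all_e] := pselect (exists i, t i s != e).
  exists (t ord0), (t i); split=> //; apply/eqP; rewrite -/e.
  have := t5 i; rewrite -(t5 ord0) => /eqP; rewrite eqf_sqr (negPf ne) //.
case/negP: e_irr; have [S _] := t_rat s; move: S.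
rewrite (eq_bigr (fun=> e)) => [|i _]; last by apply/eqP/negPn/negP => h; apply: all_e;
  exists i.
rewrite sumr_const card_ord -mulr_natl => S.
by rewrite -[e](@mulKf _ n.+1%:R) ?pnatr_eq0 // rpredM // rpredV rpred_nat.
Qed.

(* With [y = A + B s], both [2 A] and [A ^ 2 - 5 B ^ 2] are integers, being the
   trace and the norm of [y]; hence so is [2 B], and the parities agree. *)
Lemma golden_coordinates (s : K) (y : OK) : s ^+ 2 = 5%:R -> val y \in <<1; s>>%VS ->
  y \in posInt K -> exists a b : int, [/\ 0 < 2 * a + 3 * b,
    0 < a ^+ 2 + 3 * a * b + b ^+ 2 &
    val y = a%:~R + b%:~R * ((1 + s) / 2%:R) ^+ 2].
Proof.
move=> s5 /Fadjoin1_polyP [p Dp] /posIntP py.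
have [A [B Dy]] : exists A B : rat, val y = A%:A + B%:A * s.
  rewrite Dp; elim/poly_ind: p {Dp} => [|p c [A [B IH]]].
    by exists 0, 0; rewrite rmorph0 horner0 !scale0r; ring.
  exists (5%:R * B + c), A; rewrite rmorphD rmorphM /= map_polyX map_polyC !hornerE IH.
  rewrite -!/(in_alg K _) rmorphD rmorphM rmorph_nat /=.
  rewrite -s5; ring.
have [f [g [gs fs_irr]]] := conjugate_sqrt5 s5.
have fs5 : f s ^+ 2 = 5%:R by rewrite -rmorphXn s5 rmorph_nat.
have morA (h : {rmorphism K -> algC}) (q : rat) : h q%:A = ratr q.
  by rewrite alg_num_field fmorph_rat.
have fy : f (val y) = ratr A + ratr B * f s by rewrite Dy rmorphD rmorphM !morA.
have gy : g (val y) = ratr A - ratr B * f s.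
  by rewrite Dy rmorphD rmorphM !morA gs mulrN.
have [t Et] : exists t : int, f (val y) + g (val y) = t%:~R.
  apply/intrP/Cint_rat_Aint; last by rewrite rpredD ?alg_int_Aint.
  by rewrite fy gy addrACA subrr addr0 rpredD ?Crat_rat.
have [N EN] : exists N : int, f (val y) * g (val y) = N%:~R.
  apply/intrP/Cint_rat_Aint; last by rewrite rpredM ?alg_int_Aint.
  have -> : f (val y) * g (val y) = ratr (A ^+ 2 - 5%:R * B ^+ 2).
    rewrite fy gy rmorphB rmorphXn rmorphM rmorphXn rmorph_nat /= -fs5; ring.
  exact: Crat_rat.
have E2A : 2%:R * A = t%:~R.
  apply: (fmorph_inj (ratr : {rmorphism rat -> algC})).
  rewrite rmorphM rmorph_nat rmorph_int -Et fy gy /=; ring.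
have EAB : A ^+ 2 - 5%:R * B ^+ 2 = N%:~R.
  apply: (fmorph_inj (ratr : {rmorphism rat -> algC})).
  rewrite rmorphB rmorphXn rmorphM rmorphXn rmorph_nat rmorph_int -EN fy gy /= -fs5; ring.
have t_gt0 : 0 < t by rewrite -(ltr0z algC) -Et addr_gt0.
have N_gt0 : 0 < N by rewrite -(ltr0z algC) -EN mulr_gt0.
(* The square of [10 B] is the integer [5 (t ^ 2 - 4 N)], so [10 B] is an integer [m]; as 5 divides
   [m ^ 2], it divides [m], and [2 B] is the integer [b]. *)
have [m Em] : exists m : int, 10%:R * B = m%:~R.
  have : (ratr (10%:R * B) : algC) \in Num.int.
    apply: Cint_rat_Aint; first exact: Crat_rat.
    apply: Aint_sqr; rewrite -rmorphXn.
    have -> : (10%:R * B) ^+ 2 = (5 * (t ^+ 2 - 4 * N))%:~R :> rat.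
      rewrite rmorphM rmorphB rmorphXn (rmorphM _ 4) /= -E2A -EAB; ring.
    by rewrite rmorph_int rpred_int.
  case/intrP => m Em; exists m; apply: (fmorph_inj (ratr : {rmorphism rat -> algC})).
  by rewrite [LHS]Em rmorph_int.
have Em2 : m ^+ 2 = 5 * (t ^+ 2 - 4 * N).
  apply: (@intr_inj rat).
  rewrite rmorphXn (rmorphM _ 5) rmorphB rmorphXn (rmorphM _ 4) /= -Em -E2A -EAB; ring.
have [b Eb] : exists b, m = 5 * b.
  have : (5 %| `|m| ^ 2)%N by apply/dvdnP; exists `|(t ^+ 2 - 4 * N)%R|%N;
    rewrite -abszX Em2 abszM mulnC.
  rewrite Euclid_dvdX // andbT => /dvdnP [k Ek].
  by exists (m %/ 5)%Z; lia.
have Etb : t ^+ 2 = 5 * b ^+ 2 + 4 * N by move: Em2; rewrite Eb; nia.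
(* Forced by [((1 + s) / 2) ^ 2 = (3 + s) / 2]; by [Etb], [t] and [b] have the same parity. *)
have [a Ea] : exists a, t = 2 * a + 3 * b.
  exists ((t - 3 * b) %/ 2)%Z; nia.
exists a, b; split; [by rewrite -Ea | by nia |].
have E2B : 2%:R * B = b%:~R.
  apply: (@mulfI _ 5%:R) => //; rewrite mulrA -natrM Em Eb rmorphM /=; ring.
have two0 : 2%:R != 0 :> K := natr_neq0 K (ltn0Sn 1).
have EA' : 2%:R * A%:A = 2 * a%:~R + 3 * b%:~R :> K.
  have -> : 2%:R * A%:A = in_alg K (2%:R * A) by rewrite rmorphM rmorph_nat.
  by rewrite E2A rmorph_int Ea rmorphD !rmorphM.
have EB' : 2%:R * B%:A = b%:~R :> K.
  have -> : 2%:R * B%:A = in_alg K (2%:R * B) by rewrite rmorphM rmorph_nat.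
  by rewrite E2B rmorph_int.
apply: (mulfI two0); apply: (mulfI two0).
have -> : 2 * (2 * val y) = 2 * (2 * A%:A + 2 * B%:A * s) by rewrite Dy; ring.
have -> : 2 * (2 * (a%:~R + b%:~R * ((1 + s) / 2%:R) ^+ 2))
    = 4 * a%:~R + b%:~R * (2 * ((1 + s) / 2)) ^+ 2 :> K by ring.
rewrite EA' EB' (mulrC 2 (_ / _)) divfK //.
have -> : (1 + s) ^+ 2 = 6 + 2 * s by rewrite sqrrD s5; ring.
by ring.
Qed.

End RepresentingLattice.

Theorem theorem6p3 (K : fieldExtType rat) (F : {subfield K}) (X : lattice_kind)
  (K_real : totally_real K)
  (F_Q_or_Qsqrt5 : (F = 1%VS :> {vspace K}) \/
     (exists2 s : K, s ^+ 2 = 5%:R & F = <<1; s>>%VS :> {vspace K}))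
  (F_proper : (F : {vspace K}) <> fullv) :
  ~ criterion_set X (subfield_classes F) /\
  exists L : lattice K,
    [/\ X_lattice X L,
        forall b : ringInt (subvs_of F), b \in posInt (subvs_of F) ->
          represents L (ringInt_incl b) &
        ~ universal L].
Proof.
have pos1 : (1 : ringInt K) \in posInt K by apply/posIntP; rewrite rmorph1;
  apply: totally_positive1.
have F1 : val (1 : ringInt K) \in F by rewrite rmorph1; apply: rpred1.
case: F_Q_or_Qsqrt5 => [F_Q|[s s5 F_s]].
  (* Modulo 2, [rho = 2] is the square of 0. *)
  apply: (@not_universal_lattice K F K_real X (1 + 1) 1 1 0 1) => //; first by ring.
  move=> x px; have [|n ->] := pos_rational_nat (ringInt_incl_posInt px).
    by rewrite -F_Q; apply: subvsP.
  exact: represented_nat.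
have two0 : 2%:R != 0 :> K := natr_neq0 K (ltn0Sn 1).
pose phi0 : K := (1 + s) / 2%:R.
have phi0E : phi0 ^+ 2 = phi0 + 1.
  apply: (mulfI two0); apply: (mulfI two0).
  have -> : 2 * (2 * phi0 ^+ 2) = (phi0 * 2) ^+ 2 by ring.
  have -> : 2 * (2 * (phi0 + 1)) = 2 * (phi0 * 2) + 4 by ring.
  by rewrite /phi0 divfK // sqrrD s5; ring.
have phi_int : is_alg_int phi0.
  apply/asboolP; exists ('X^2 - ('X + 1)).
    rewrite monicE lead_coefDl ?lead_coefXn // size_polyXn size_polyN.
    by rewrite -[1]/(1%:P) size_XaddC.
  rewrite rmorphB rmorphD rmorph1 /= map_polyXn map_polyX /root !hornerE phi0E.
  by rewrite subrr.
pose phi : ringInt K := RingInt phi_int.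
have phiE : phi ^+ 2 = phi + 1 by apply: val_inj; rewrite rmorphXn rmorphD rmorph1;
  exact: phi0E.
have Fs : s \in F by rewrite (_ : (s \in F) = (s \in (F : {vspace K}))) // F_s memv_adjoin.
have Fphi : val (phi ^+ 2) \in F.
  by rewrite rmorphXn rpredX //= rpredM ?rpredD ?rpred1 // rpredV rpred_nat.
have phi_pos : phi ^+ 2 \in posInt K.
  apply/posIntP; rewrite rmorphXn; apply: totally_nonneg_pos;
    last exact: totally_nonneg_sqr.
  apply: expf_neq0; apply/eqP => phi00; have := phi0E.
  by rewrite [phi0]phi00 expr0n add0r => /eqP; rewrite eq_sym oner_eq0.
(* Besides [1 + phi ^ 2], [rho] is [(phi ^ 2) ^ 2 - 2 phi], because [phi ^ 4 = 3 phi + 2]. *)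
apply: (@not_universal_lattice K F K_real X (phi + 2) 1 (phi ^+ 2) (phi ^+ 2) (- phi)) => //.
- by rewrite phiE; ring.
- by apply: (golden_eq phiE (c := - (phi ^+ 2 + phi + 2))); ring.
move=> x px; have := ringInt_incl_posInt px => px'.
have Fx : val (ringInt_incl x) \in <<1; s>>%VS by rewrite -F_s; apply: subvsP.
have [a [b [tr_gt0 nm_gt0 Ex]]] := golden_coordinates s5 Fx px'.
have -> : ringInt_incl x = a%:~R + b%:~R * phi ^+ 2.
  by apply: val_inj; rewrite Ex rmorphD rmorphM !rmorph_int rmorphXn.
exact: represented_golden.
Qed.
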